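(* For every integer $n\ge 0$, let $\mathcal B_n$ be the simple graph on vertex set $\{0,1,\ldots,n+1\}$ whose $2n+1$ edges are $(0\,1)$ together with $(0\,i)$ and $(1\,i)$ for all $i\in\{2,3,\ldots,n+1\}$. Then $\mathcal B_n$ is a minimal perm-complete graph: it is perm-complete, and for each edge $e$ of $\mathcal B_n$, the graph on the same vertex set obtained by deleting $e$ is not perm-complete.
   Context: For a finite set $X$, $\mathrm{Sym}(X)$ and $\mathrm{Alt}(X)$ are the symmetric and alternating groups on $X$; permutations are composed left to right. For a finite sequence $\mathbf s=\langle s_0,\ldots,s_{k-1}\rangle$ in $\mathrm{Sym}(X)$, $\bigcirc\mathbf s=s_0\circ\cdots\circ s_{k-1}$, $\mathrm{Seq}(\mathbf s)$ is the set of its rearrangements, and $\mathrm{Prod}(\mathbf s)=\{\bigcirc\mathbf r:\mathbf r\in\mathrm{Seq}(\mathbf s)\}$; $\mathbf s$ is perm-complete iff $\mathrm{Prod}(\mathbf s)$ equals $\mathrm{Alt}(X)$ or $\mathrm{Sym}(X)\setminus\mathrm{Alt}(X)$. A simple graph $\mathcal G$ with vertex set $X$ is called perm-complete iff the transpositional sequence listing each edge $(x\,y)$ of $\mathcal G$ exactly once, as the transposition $(x\,y)\in\mathrm{Sym}(X)$, is perm-complete (this does not depend on the order of listing).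
   Formalization: A perm-complete sequence is required to be nonempty; otherwise, for n = 0, deleting the edge (0 1) leaves the empty sequence with product set {1} = Alt({0,1}), so minimality would fail. For n ≥ 1 this proviso changes nothing. *)

(* Defs.v *)
From HB Require Import structures.
From mathcomp Require Import all_boot all_order all_fingroup all_solvable.

Set Implicit Arguments.
Unset Strict Implicit.
Unset Printing Implicit Defensive.

Local Open Scope group_scope.

(* In [{perm T}], [(s * t) x = t (s x)]: products are composed left to right. *)
Definition Prod (T : finType) (s : seq {perm T}) : {set {perm T}} :=
  [set p | p \in [seq \prod_(t <- r) t | r <- permutations s]].

(* A sequence <s_0, ..., s_(k-1)> is taken to have k >= 1.  With an empty     *)
(* composite equal to 1, the empty sequence would be perm-complete exactly    *)
(* when #|T| <= 2 (as then 'Alt_T = 1), and a single edge on two vertices     *)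
(* would not be a minimal perm-complete graph.  The proviso is vacuous when   *)
(* 2 < #|T|: see [perm_complete_gt2].                                         *)
Definition perm_complete (T : finType) (s : seq {perm T}) : Prop :=
  s <> [::] /\ (Prod s = 'Alt_T \/ Prod s = 'Sym_T :\: 'Alt_T).

Record sgraph (T : finType) := SGraph {
  edge :> rel T;
  edge_sym : symmetric edge;
  edge_irr : irreflexive edge
}.

(* Distinct edges give distinct transpositions, so enumerating this set lists *)
(* each edge exactly once.                                                    *)
Definition edge_transpositions (T : finType) (G : sgraph T) : {set {perm T}} :=
  [set p | [exists x, exists y, G x y && (p == tperm x y)]].

Definition perm_complete_graph (T : finType) (G : sgraph T) : Prop :=
  perm_complete (enum (edge_transpositions G)).

Section DeleteEdge.
Variables (T : finType) (G : sgraph T) (x y : T).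

Definition del_edge_rel : rel T :=
  fun u v => G u v && ([set u; v] != [set x; y]).

Fact del_edge_sym : symmetric del_edge_rel.
Proof. by move=> u v; rewrite /del_edge_rel edge_sym setUC. Qed.

Fact del_edge_irr : irreflexive del_edge_rel.
Proof. by move=> u; rewrite /del_edge_rel edge_irr. Qed.

Definition del_edge : sgraph T := SGraph del_edge_sym del_edge_irr.

End DeleteEdge.

Definition minimal_perm_complete_graph (T : finType) (G : sgraph T) : Prop :=
  perm_complete_graph G /\
  (forall x y : T, G x y -> ~ perm_complete_graph (del_edge G x y)).

Section BookGraph.
Variable n : nat.

Definition B_arc (i j : 'I_n.+2) : bool :=
  [|| (i == 0 :> nat) && (j == 1%N :> nat),
      (i == 0 :> nat) && (2 <= j) |
      (i == 1%N :> nat) && (2 <= j)].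

Definition B_rel : rel 'I_n.+2 := fun i j => B_arc i j || B_arc j i.

Fact B_sym : symmetric B_rel.
Proof. by move=> i j; rewrite /B_rel orbC. Qed.

Fact B_irr : irreflexive B_rel.
Proof. by move=> [[|[|i]] ?]. Qed.

Definition B_graph : sgraph 'I_n.+2 := SGraph B_sym B_irr.

End BookGraph.

Lemma Prod_perm (T : finType) (s t : seq {perm T}) :
  perm_eq s t -> Prod s = Prod t.
Proof.
move=> st; apply/setP=> p; rewrite !inE.
by apply: eq_mem_map => r; rewrite !mem_permutations (permPr st).
Qed.

Lemma perm_complete_perm (T : finType) (s t : seq {perm T}) :
  perm_eq s t -> perm_complete s -> perm_complete t.
Proof.
move=> st [s0 h]; split; last by rewrite -(Prod_perm st).
by move=> t0; apply: s0; apply: perm_nilP; rewrite -t0.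
Qed.

Lemma perm_complete_gt2 (T : finType) (s : seq {perm T}) : 2 < #|T| ->
  perm_complete s <-> (Prod s = 'Alt_T \/ Prod s = 'Sym_T :\: 'Alt_T).
Proof.
move=> T2; split=> [[]//|h]; split=> // s0; subst s.
have P1 : Prod [::] = [set (1 : {perm T})].
  by apply/setP=> p; rewrite !inE /= big_nil.
case: h; rewrite P1 => h.
  have := card_Alt (ltnW T2); rewrite -h cards1 => e.
  by have := fact_geq #|T|; rewrite -e leqNgt T2.
by move/setP/(_ 1): h; rewrite in_set1 eqxx in_setD group1.
Qed.

Lemma edge_transpositions_inj (T : finType) (G : sgraph T) (x y u v : T) :
  G x y -> tperm x y = tperm u v -> [set x; y] = [set u; v].
Proof.
move=> Gxy e; have xy : x != y by apply: contraTneq Gxy => ->; rewrite edge_irr.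
have := congr1 (fun p : {perm T} => p x) e; rewrite /= tpermL.
case: tpermP => [-> -> //|-> ->|_ _ yx]; first by rewrite setUC.
by rewrite yx eqxx in xy.
Qed.

Lemma edge_transpositionsP (T : finType) (G : sgraph T) (p : {perm T}) :
  reflect (exists x y, G x y /\ p = tperm x y) (p \in edge_transpositions G).
Proof.
rewrite inE; apply: (iffP existsP) => [[x /existsP[y /andP[Gxy /eqP->]]]|].
  by exists x, y.
by move=> [x [y [Gxy ->]]]; exists x; apply/existsP; exists y; rewrite Gxy /=.
Qed.

(* Main.v *)
Require Import Defs.
From mathcomp Require Import all_boot all_order all_fingroup all_solvable.
From mathcomp Require Import zify.

(** Perm-completeness. Let [p] be an odd permutation of the book with spine [a],
[b]. If [p] moves [a] to an outer vertex [x], then [p = (b x)(a x) q] with [q]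
fixing [x]; if [p] moves [a] to [b], then [p = (a x) q (b x)] with [q] fixing
any outer vertex [x]; in both cases recurse on [q], and likewise for [b]. If [p]
fixes [a] and [b], being odd it has a cycle [(i l_1 .. l_2m k)] of even length.
Since [(b j)(a j)(a k)(b k) = (a j)(a k)], the spokes at the [l_t] multiply to
[(a l_1)..(a l_2m)], and
[(a i) (a l_1)..(a l_2m) (b k)(a k)(b i) = (i l_1 .. l_2m k)(a b)]
uses each spoke of the cycle once; what remains is an odd permutation fixing the
whole cycle.

Minimality. A connected graph on [N] vertices needs at least [2N - 2]
transpositions to multiply to [1]. Deleting an edge leaves [2n] edges, an even
number, on [n + 2] vertices, so [1] is an even permutation out of reach (and for
[n = 0] no edge remains). *)

Set Implicit Arguments.
Unset Strict Implicit.
Unset Printing Implicit Defensive.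

Local Open Scope group_scope.

(** * Products over rearrangements and their parity *)

Lemma ProdP (T : finType) (s : seq {perm T}) (p : {perm T}) :
  reflect (exists2 r, perm_eq r s & p = \prod_(t <- r) t) (p \in Prod s).
Proof.
rewrite inE; apply: (iffP mapP) => -[r rs ->]; exists r => //.
  by rewrite -mem_permutations.
by rewrite mem_permutations.
Qed.

Lemma Prod_cat (T : finType) (s t : seq {perm T}) (p q : {perm T}) :
  p \in Prod s -> q \in Prod t -> p * q \in Prod (s ++ t).
Proof.
move=> /ProdP[r rs ->] /ProdP[r' rt ->]; apply/ProdP; exists (r ++ r').
  exact: perm_cat.
by rewrite big_cat.
Qed.

Lemma mem_Prod_perm (T : finType) (s t : seq {perm T}) (p : {perm T}) :
  perm_eq s t -> p \in Prod s -> p \in Prod t.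
Proof. by move=> /Prod_perm->. Qed.

Lemma prod_in_Prod (T : finType) (s : seq {perm T}) :
  \prod_(t <- s) t \in Prod s.
Proof. by apply/ProdP; exists s. Qed.

Lemma odd_Prod (T : finType) (s : seq {perm T}) (p : {perm T}) :
  {in s, forall t : {perm T}, odd_perm t} -> p \in Prod s ->
  odd_perm p = odd (size s).
Proof.
move=> s_odd /ProdP[r rs ->]; rewrite -(perm_size rs).
have {s_odd rs} : {in r, forall t, odd_perm t}.
  by move=> t; rewrite (perm_mem rs) => /s_odd.
elim: r => [|t r IHr] r_odd; first by rewrite big_nil odd_perm1.
rewrite big_cons odd_permM r_odd ?mem_head // IHr // => u ur.
by rewrite r_odd // in_cons ur orbT.
Qed.

Lemma tperm_inj (T : finType) (a : T) : injective (tperm a).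
Proof. by move=> x y /permP/(_ a); rewrite !tpermL. Qed.

(** * Cycle counts of products of transpositions *)

Lemma porbits1 (T : finType) : #|porbits (1 : {perm T})| = #|T|.
Proof.
rewrite /porbits card_in_imset // => x y _ _ exy.
have := porbit_id 1 x; rewrite exy => /porbitP[i ->].
by rewrite expg1n perm1.
Qed.

(* Genus bound: a new transposition either joins two classes of [f], and then *)
(* also two cycles of the product, or creates at most one new cycle.          *)
Lemma porbits_prod_transpositions (T : finType) (s : seq {perm T}) :
    {in s, forall t : {perm T}, exists x y, x != y /\ t = tperm x y} ->
  exists2 f : T -> T, {in s, forall t : {perm T}, forall z, f (t z) = f z} &
    #|T| + #|porbits (\prod_(t <- s) t)| <= size s + (#|f @: setT|).*2.
Proof.
elim: s => [|t s IHs] ts.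
  by exists id => //; rewrite big_nil porbits1 imset_id cardsT addnn.
case: IHs => [u us|f fs le_f]; first by apply: ts; rewrite in_cons us orbT.
case: (ts t) => [|x [y [xy ->]]]; first exact: mem_head.
rewrite big_cons /=; set q := \prod_(u <- s) u in le_f *.
have := porbits_mul_tperm q x y; rewrite /= xy => cyc.
(* Inside one class the labelling is kept: the length grows by one and the number of cycles by at
   most one. *)
have [fxy|fxy] := eqVneq (f x) (f y).
  exists f; last by move: cyc le_f; case: (_ \notin _) => /=; lia.
  move=> u; rewrite in_cons => /predU1P[-> z|/fs//].
  by case: tpermP => // ->.
have fq : forall z, f (q z) = f z.
  rewrite /q; elim: (s) fs => [|u r IHr] fr z; first by rewrite big_nil perm1.
  rewrite big_cons permM IHr ?fr ?mem_head // => v vr.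
  by apply: fr; rewrite in_cons vr orbT.
(* [q] preserves the classes, so points of different classes lie on different cycles of [q], and the
   new transposition joins these two cycles. *)
have x_y : x \notin porbit q y.
  apply: contra fxy => /porbitP[i ->]; apply/eqP.
  by elim: i => [|i IHi]; rewrite ?expg0 ?perm1 // expgSr permM fq.
rewrite x_y /= in cyc.
exists (fun z => if f z == f x then f y else f z).
  move=> u; rewrite in_cons => /predU1P[-> z|/fs fu z]; last by rewrite fu.
  case: tpermP => // ->; first by rewrite eqxx eq_sym (negPf fxy).
  by rewrite eqxx eq_sym (negPf fxy).
set f' := fun z => _.
(* Relabelling the class of [x] as that of [y] loses at most one class. Both sides of the bound then
   drop by one: one cycle less on the left, one more factor and two less from the doubled class
   count on the right. *)
suff /subset_leq_card : f @: setT \subset f x |: f' @: setT.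
  by rewrite cardsU1; move: cyc le_f; case: (_ \notin _) => /=; lia.
apply/subsetP=> _ /imsetP[z _ ->]; rewrite !inE.
have [//|fz] /= := eqVneq (f z) (f x).
by apply/imsetP; exists z; rewrite // /f' (negPf fz).
Qed.

(** The sign is the parity of [#|T|] plus the number of cycles; were all cycles of odd length, these
    two numbers would have the same parity. *)
Lemma odd_perm_even_porbit (T : finType) (p : {perm T}) :
  odd_perm p -> exists x, ~~ odd #|porbit p x|.
Proof.
move=> p_odd; apply/existsP; apply: contraLR p_odd => /existsPn all_odd.
have part : partition (porbits p) setT.
  have -> : porbits p = orbit 'P <[p]> @: setT.
    apply/setP=> A; apply/imsetP/imsetP => -[x _ ->];
      by exists x; rewrite ?inE ?porbitE.
  by apply: orbit_partition; apply/actsP=> a _ z; rewrite !inE.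
rewrite /odd_perm -[in odd #|T|]cardsT (card_partition part).
rewrite (big_morph odd oddD (erefl : odd 0 = false)).
rewrite -sum1_card (big_morph odd oddD (erefl : odd 0 = false)).
rewrite negb_add; apply/eqP/eq_bigr => A /imsetP[x _ ->].
by rewrite -[LHS]negbK; rewrite all_odd.
Qed.

(** * Stars and even cycles as products of spokes *)

Definition spokes (T : finType) (a b : T) (V : seq T) : seq {perm T} :=
  map (tperm a) V ++ map (tperm b) V.

(* [lia] case-splits on every boolean coerced to [nat]. *)
Ltac perm_count :=
  apply/seq.permP=> ?; rewrite /spokes /= ?map_cat ?map_rcons -?cats1;
  repeat progress rewrite ?count_cat /=;
  repeat match goal with
  | |- context [nat_of_bool ?b] => move: (nat_of_bool b) => ?
  | |- context [count ?P ?r] => move: (count P r) => ?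
  end; clear; lia.

Section Book.
Variable T : finType.
Implicit Types (a b i x z : T) (p q : {perm T}) (V s : seq T).


Lemma spokes_perm a b V V' :
  perm_eq V V' -> perm_eq (spokes a b V) (spokes a b V').
Proof. by move=> VV'; apply: perm_cat; apply: perm_map. Qed.

Lemma spokesC a b V : perm_eq (spokes a b V) (spokes b a V).
Proof. by rewrite /spokes perm_catC. Qed.

Lemma spokes_cat a b V V' :
  perm_eq (spokes a b (V ++ V')) (spokes a b V ++ spokes a b V').
Proof. by perm_count. Qed.

Lemma star_out a s z :
  z != a -> z \notin s -> (\prod_(x <- s) tperm a x) z = z.
Proof.
move=> za; elim: s => [|x s IHs]; first by rewrite big_nil perm1.
rewrite in_cons negb_or => /andP[zx /IHs zs].
by rewrite big_cons permM tpermD // eq_sym.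
Qed.

(** Composed left to right, a point of the star is carried to [a] by its own factor and from there
    to the next point by the following factor; the last point has no following factor and stays at
    [a]. *)
Lemma star_traject a p i m t : uniq (a :: traject p i m.+1) -> t <= m ->
  (\prod_(x <- traject p i m.+1) tperm a x) (iter t p i) =
    if t == m then a else iter t.+1 p i.
Proof.
elim: m t => [|m IHm] t; first by case: t => //= _ _; rewrite big_seq1 tpermR.
rewrite trajectSr -rcons_cons rcons_uniq => /andP[xm um] tm.
have := xm; rewrite in_cons negb_or => /andP[xa xt].
rewrite -cats1 big_cat big_seq1 /= permM.
have [->|tm'] := eqVneq t m.+1.
  by rewrite star_out ?tpermR.
have {tm'}tm : t <= m by lia.
rewrite IHm //; have [->|tm'] := eqVneq t m; first by rewrite tpermL.
have ty : iter t.+1 p i \in traject p i m.+1.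
  by apply/trajectP; exists t.+1 => //; lia.
move: um => /= /andP[at_ _]; rewrite tpermD //.
  by apply: contraNneq at_ => ->.
by apply: contraNneq xt => /= ->.
Qed.

(** Both sides are the 3-cycle b -> a -> x -> b. Together with the inverse form below, this lets the
    two copies of [tperm a b] cancel in the product of the four spokes at a pair of points. *)
Lemma tperm_spokes a b x : a != b -> a != x -> b != x ->
  tperm b x * tperm a x = tperm a x * tperm a b.
Proof.
by move=> ab ax bx; rewrite conjgC tpermJ tpermR tpermD ?(tpermC b) // eq_sym.
Qed.

Lemma tperm_spokesV a b x : a != b -> a != x -> b != x ->
  tperm a x * tperm b x = tperm a b * tperm a x.
Proof.
move=> ab ax bx; apply: invg_inj.
by rewrite !invMg !tpermV tperm_spokes.
Qed.

Lemma star_in_Prod a b s : uniq (a :: b :: s) -> ~~ odd (size s) ->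
  \prod_(x <- s) tperm a x \in Prod (spokes a b s).
Proof.
(* Points are consumed two at a time, so the induction is on half the size. *)
move: {2}(size s)./2 (erefl (size s)./2) => m.
elim: m s => [|m IHm] [|x [|y s]] //= sz.
  by have := prod_in_Prod (spokes a b [::]); rewrite !big_nil.
rewrite !in_cons !negb_or -!andbA negbK.
move=> /and5P[ab ax ay as_ /and5P[bx b_y bs xy /and3P[xs ys us]]] s_even.
have P4 : tperm a x * tperm a y \in
    Prod [:: tperm b x; tperm a x; tperm a y; tperm b y].
  have -> : tperm a x * tperm a y =
      \prod_(t <- [:: tperm b x; tperm a x; tperm a y; tperm b y]) t.
    rewrite !big_cons big_nil mulg1 mulgA (@tperm_spokes a b x) //.
    rewrite (@tperm_spokesV a b y) //.
    by rewrite mulgA -[in RHS](mulgA (tperm a x)) tperm2 mulg1.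
  exact: prod_in_Prod.
have Ps : \prod_(x <- s) tperm a x \in Prod (spokes a b s).
  by apply: IHm => //=; [case: sz | rewrite inE negb_or ab as_ bs us].
rewrite !big_cons mulgA.
rewrite (Prod_perm (t := [:: tperm b x; tperm a x; tperm a y; tperm b y]
                         ++ spokes a b s)); first exact: Prod_cat.
by perm_count.
Qed.

(* The orbit of [i] is completed to an even permutation by swapping [a] and   *)
(* [b]; [tperm b i] and the two spokes of the last point close the star up.   *)
Lemma even_cycle_in_Prod a b p i m :
    uniq (a :: b :: traject p i m.+2) -> ~~ odd m -> iter m.+2 p i = i ->
  exists c : {perm T},
    [/\ c \in Prod (spokes a b (traject p i m.+2)),
        {in traject p i m.+2, forall z, c z = p z} &
        forall z, z \notin a :: b :: traject p i m.+2 -> c z = z].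
Proof.
move=> u m_even ip; set k := iter m.+1 p i.
exists ((\prod_(x <- traject p i m.+1) tperm a x)
        * (tperm b k * tperm a k * tperm b i)).
have sub z : z \in traject p i m.+1 -> z \in traject p i m.+2.
  by rewrite [traject p i m.+2]trajectSr mem_rcons in_cons => ->; rewrite orbT.
have i_tr : i \in traject p i m.+2 by rewrite /= mem_head.
have k_tr : k \in traject p i m.+2 by apply/trajectP; exists m.+1.
move: u; rewrite 2!cons_uniq in_cons negb_or => /and3P[/andP[ab atr] btr utr].
have [ki utr1] : k \notin traject p i m.+1 /\ uniq (traject p i m.+1).
  by move: utr; rewrite trajectSr rcons_uniq => /andP[].
have neqa z : z \in traject p i m.+2 -> a != z.
  by move=> ztr; apply: contraNneq atr => ->.
have neqb z : z \in traject p i m.+2 -> b != z.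
  by move=> ztr; apply: contraNneq btr => ->.
have ba : b != a by rewrite eq_sym.
have ik : i != k by apply: contraNneq ki => <-; rewrite /= mem_head.
split.
- set l := traject p (p i) m.
  have tr1 : traject p i m.+2 = i :: rcons l k.
    by rewrite [LHS]/= -/(traject p (p i) m.+1) trajectSr -iterSr.
  have Pl : \prod_(x <- l) tperm a x \in Prod (spokes a b l).
    apply: star_in_Prod; last by rewrite size_traject.
    move: atr btr utr; rewrite tr1 /= !in_cons !mem_rcons !in_cons rcons_uniq.
    rewrite !negb_or => /and3P[_ _ ->] /and3P[_ _ ->].
    by rewrite ab => /andP[_ /andP[_ ->]].
  rewrite [traject p i m.+1]/= -/l big_cons tr1 -mulgA.
  rewrite (Prod_perm (t := [:: tperm a i] ++ (spokes a b l ++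
     [:: tperm b k; tperm a k; tperm b i]))); last first.
    by perm_count.
  have P1 : tperm a i \in Prod [:: tperm a i].
    by have := prod_in_Prod [:: tperm a i]; rewrite big_seq1.
  apply: (Prod_cat P1); apply: (Prod_cat Pl).
  have := prod_in_Prod [:: tperm b k; tperm a k; tperm b i].
  by rewrite !big_cons big_nil mulg1 mulgA.
(* The star fixes [k], which then goes to [b] and on to [i]; the point before [k] goes to [a] and
   then to [k]; any other point is advanced by the star, and its image is fixed by the three closing
   factors. *)
- move=> z /trajectP[t tm ->]; rewrite 3!permM.
  have [->|tm1] := eqVneq t m.+1.
    rewrite -/k star_out 1?eq_sym ?neqa // tpermR (tpermD ab) //.
      by rewrite tpermL -iterS.
    by rewrite eq_sym neqb.
  have tm3 : t <= m by clear -tm tm1; lia.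
  have utr2 : uniq (a :: traject p i m.+1).
    by rewrite cons_uniq utr1 andbT; apply: contra atr => /sub.
  rewrite star_traject //.
  rewrite -iterS; have [->|tm2] := eqVneq t m.
    have ka : k != a by rewrite eq_sym neqa.
    by rewrite (tpermD ba ka) tpermL (tpermD (neqb _ k_tr) ik).
  set y := iter t.+1 p i.
  have tm4 : t.+1 < m.+1 by rewrite ltnS ltn_neqAle tm2.
  have ytr : y \in traject p i m.+1 by apply/trajectP; exists t.+1.
  have ky : k != y by apply: contraNneq ki => ->.
  have iy : i != y.
    apply/eqP => iy; have /(congr1 (fun z => index z (traject p i m.+2))) := iy.
    have -> : i = nth i (traject p i m.+2) 0 by [].
    rewrite /y -(@nth_traject _ p t.+1 m.+2) ?index_uniq ?size_traject // ltnW.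
  by rewrite !tpermD // ?neqa ?neqb ?sub.
move=> z; rewrite 2!in_cons 2!negb_or => /and3P[za zb ztr].
have ztr1 : z \notin traject p i m.+1 by apply: contra ztr => /sub.
have kz : k != z by apply: contraNneq ztr => <-.
have iz : i != z by apply: contraNneq ztr => <-.
by rewrite 3!permM star_out // !tpermD // eq_sym.
Qed.

(** * Odd permutations of a book *)

Lemma uniq_spokes a b V : uniq (a :: b :: V) ->
  uniq (tperm a b :: spokes a b V).
Proof.
rewrite 2!cons_uniq in_cons negb_or => /and3P[/andP[ab aV] bV uV].
rewrite cons_uniq mem_cat cat_uniq !(map_inj_uniq (@tperm_inj _ _)) uV.
rewrite (mem_map (@tperm_inj _ _)) tpermC.
rewrite (mem_map (@tperm_inj _ _)) negb_or bV aV /= andbT.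
apply/hasPn=> _ /mapP[x xV ->]; apply/mapP => -[y yV] /permP/(_ a).
rewrite tpermL tpermD //; first by move=> ay; rewrite ay yV in aV.
  by rewrite eq_sym.
by apply: contraNneq aV => <-.
Qed.

Lemma odd_spokes a b V : a \notin V -> b \notin V ->
  {in spokes a b V, forall t : {perm T}, odd_perm t}.
Proof.
move=> aV bV t; rewrite mem_cat => /orP[] /mapP[x xV ->]; rewrite odd_tperm.
  by apply: contraNneq aV => ->.
by apply: contraNneq bV => ->.
Qed.

Lemma size_spokes a b V : size (spokes a b V) = (size V).*2.
Proof. by rewrite size_cat !size_map addnn. Qed.

(** The book may be smaller than [T], with [p] the identity off it, so that the induction on the
    number of outer vertices can drop vertices while [T] stays the same. *)
Lemma book_complete a b V p : uniq (a :: b :: V) -> odd_perm p ->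
    (forall z, z \notin a :: b :: V -> p z = z) ->
  p \in Prod (tperm a b :: spokes a b V).
Proof.
have [N] := ubnP (size V); elim: N => // N IH in a b V p *.
(* This case is stated for an arbitrary spine because it is also applied with the roles of [a] and
   [b] exchanged. *)
have moved a' b' V' q : size V' < N.+1 -> uniq (a' :: b' :: V') -> odd_perm q ->
    (forall z, z \notin a' :: b' :: V' -> q z = z) -> q a' != a' ->
    q \in Prod (tperm a' b' :: spokes a' b' V').
  move=> {a b V p}; move: a' b' V' q => a b V p szV u p_odd pV pa.
  have := u; rewrite 2!cons_uniq in_cons negb_or => /and3P[/andP[ab aV] bV uV].
  have ba : b != a by rewrite eq_sym.
  have neqa z : z \in V -> a != z by move=> zV; apply: contraNneq aV => ->.
  have neqb z : z \in V -> b != z by move=> zV; apply: contraNneq bV => ->.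
  have paV : p a \in a :: b :: V.
    by apply: contraNT pa => /pV/perm_inj->.
  move: paV; rewrite in_cons (negPf pa) in_cons /= => /predU1P[pab|].
    case: V => [|x V] in szV u pV aV bV uV neqa neqb *.
      suff -> : p = tperm a b.
        by have := prod_in_Prod [:: tperm a b]; rewrite big_seq1.
      have pz z : z != a -> z != b -> p z = z.
        by move=> za zb; apply: pV; rewrite !inE negb_or za.
      (* If [p b] were off the spine, [p] would fix it, and injectivity would make [b] a fixed
         point, contrary to [p a = b]. *)
      have pb : p b = a.
        have pbb : p b != b by rewrite -[X in _ != X]pab (inj_eq perm_inj).
        apply/eqP/negPn/negP => pba; have /perm_inj pb := pz _ pba pbb.
        by rewrite pb eqxx in pbb.
      by apply/permP=> z; case: tpermP => [->|->|/eqP za /eqP zb] //; apply: pz.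
    have xV := mem_head x V; have [ax bx] := (neqa _ xV, neqb _ xV).
    have qP : tperm a x * p * tperm b x \in Prod (tperm a b :: spokes a b V).
      apply: IH => //.
      - move: u; rewrite /= !in_cons !negb_or.
        by move=> /and4P[/and3P[-> _ ->]] /andP[_ ->] _ ->.
      - by rewrite !odd_permM !odd_tperm ax bx p_odd.
      move=> z zV; rewrite !permM.
      have [->|zx] := eqVneq z x; first by rewrite tpermR pab tpermL.
      move: (zV); rewrite !in_cons !negb_or => /and3P[za zb _].
      have pz : p z = z by apply: pV; move: zV; rewrite !in_cons !negb_or zx.
      have [az bz xz] : [/\ a != z, b != z & x != z] by rewrite ![_ == z]eq_sym.
      by rewrite (tpermD az xz) pz tpermD.
    have pE : tperm a x * ((tperm a x * p * tperm b x) * tperm b x) = p.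
      by rewrite !mulgA tperm2 mul1g -mulgA tperm2 mulg1.
    have Pa : tperm a x \in Prod [:: tperm a x].
      by have := prod_in_Prod [:: tperm a x]; rewrite big_seq1.
    have Pb : tperm b x \in Prod [:: tperm b x].
      by have := prod_in_Prod [:: tperm b x]; rewrite big_seq1.
    have := Prod_cat Pa (Prod_cat qP Pb); rewrite pE.
    by apply: mem_Prod_perm; perm_count.
  set x := p a => xV; have Vx := perm_to_rem xV.
  have [ax bx] := (neqa _ xV, neqb _ xV).
  have qP : tperm a x * tperm b x * p
      \in Prod (tperm a b :: spokes a b (rem x V)).
    apply: IH.
    - by move: szV; rewrite (perm_size Vx).
    - by rewrite 2!cons_uniq in_cons negb_or ab !mem_rem_uniq // !inE
         !negb_and aV bV !orbT rem_uniq.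
    - by rewrite !odd_permM !odd_tperm ax bx p_odd.
    move=> z; rewrite !in_cons mem_rem_uniq // !inE !negb_or negb_and negbK.
    rewrite !permM.
    case/and3P=> za zb; have [-> _|zx /= zV] := eqVneq z x.
      by rewrite tpermR tpermD // eq_sym.
    have pz : p z = z by apply: pV; rewrite !in_cons !negb_or za zb.
    have [az bz xz] : [/\ a != z, b != z & x != z] by rewrite ![_ == z]eq_sym.
    by rewrite (tpermD az xz) (tpermD bz xz).
  have pE : tperm b x * tperm a x * (tperm a x * tperm b x * p) = p.
    by rewrite !mulgA -[_ * _ * tperm a x]mulgA tperm2 mulg1 tperm2 mul1g.
  have Px : tperm b x * tperm a x \in Prod [:: tperm b x; tperm a x].
    have := prod_in_Prod [:: tperm b x; tperm a x].
    by rewrite !big_cons big_nil mulg1.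
  have := Prod_cat Px qP; rewrite pE; apply: mem_Prod_perm.
  apply: (@perm_trans _ (tperm a b :: spokes a b (x :: rem x V))).
    by perm_count.
  by rewrite perm_cons spokes_perm // perm_sym.
move=> szV u p_odd pV.
have [pa|pa] := eqVneq (p a) a; last exact: moved.
have [pb|pb] := eqVneq (p b) b; last first.
  rewrite tpermC (Prod_perm (t := tperm b a :: spokes b a V)).
    apply: moved => //.
      move: u; rewrite /= !in_cons !negb_or [a == b]eq_sym.
      by move=> /and3P[/andP[-> ->] -> ->].
    by move=> z zV; apply: pV; move: zV; rewrite !in_cons orbCA.
  by rewrite perm_cons spokesC.
have [x x_even] := odd_perm_even_porbit p_odd.
have := card_porbit_neq0 p x; case E : #|porbit p x| => [|[|m]] // _.
  by rewrite E in x_even.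
have m_even : ~~ odd m by rewrite E /= negbK in x_even.
pose O := traject p x m.+2.
have OE z : (z \in O) = (z \in porbit p x) by rewrite porbit_traject E.
have uO : uniq O by rewrite /O -E uniq_traject_porbit.
(* The cycle has at least two points, so none of them is fixed; hence it avoids the spine and lies
   among the outer vertices. *)
have Omoved z : z \in O -> p z != z.
  rewrite OE -eq_porbit_mem => /eqP ez; have := uniq_traject_porbit p z.
  by rewrite ez E /= in_cons negb_or eq_sym => /andP[/andP[]].
have aO : a \notin O by apply/negP => /Omoved; rewrite pa eqxx.
have bO : b \notin O by apply/negP => /Omoved; rewrite pb eqxx.
have OV z : z \in O -> z \in V.
  move=> zO; have := Omoved z zO; apply: contraNT => zV; apply/eqP/pV.
  by rewrite !in_cons !negb_or zV andbT; apply/andP; split;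
    [apply: contraNneq aO => <- | apply: contraNneq bO => <-].
have := u; rewrite 2!cons_uniq in_cons negb_or => /and3P[/andP[ab aV] bV uV].
pose V' := [seq z <- V | z \notin O].
have VE : perm_eq V (O ++ V').
  apply: uniq_perm => //.
    rewrite cat_uniq uO filter_uniq // andbT /=; apply/hasPn => z.
    by rewrite mem_filter => /andP[].
  move=> z; rewrite mem_cat mem_filter.
  by have [/OV|] := boolP (z \in O).
have uabO : uniq (a :: b :: O).
  by rewrite 2!cons_uniq in_cons negb_or ab aO bO uO.
have px : iter m.+2 p x = x by rewrite -E iter_porbit.
have [c [cP cO c_out]] := even_cycle_in_Prod uabO m_even px.
(* [c] is a product of evenly many spokes, so the quotient stays odd. It fixes every point of the
   cycle, where [c] and [p] agree, and the induction hypothesis leaves its action on the spine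
   free. *)
have qP : c^-1 * p \in Prod (tperm a b :: spokes a b V').
  apply: IH.
  - move: szV; rewrite (perm_size VE) size_cat size_traject ltnS.
    by apply: leq_trans; rewrite -add1n leq_add2r.
  - by rewrite 2!cons_uniq in_cons negb_or ab !mem_filter !negb_and aV bV
      !orbT filter_uniq.
  - rewrite odd_permM odd_permV p_odd (odd_Prod (odd_spokes aO bO) cP).
    by rewrite size_spokes odd_double.
  move=> z; rewrite !in_cons !negb_or mem_filter negb_and negbK permM.
  move=> /and3P[za zb]; have [zO _|zO /= zV] := boolP (z \in O).
    pose y := p^-1 z; have zy : z = p y by rewrite permKV.
    have yO : y \in O.
      have := porbit_perm p 1 y; rewrite expg1 -zy => ezy.
      by move: zO; rewrite !OE -!eq_porbit_mem ezy.
    have cy : c y = z by rewrite cO.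
    by rewrite -{1}cy permK.
  have cz : c z = z by apply: c_out; rewrite 2!in_cons 2!negb_or za zb.
  by rewrite -{1}cz permK pV // !in_cons !negb_or za zb.
have := Prod_cat cP qP; rewrite mulKVg; apply: mem_Prod_perm.
apply: (@perm_trans _ (tperm a b :: spokes a b (O ++ V'))).
  by rewrite -/O; perm_count.
by rewrite perm_cons spokes_perm // perm_sym.
Qed.

End Book.

(** * The book graph and its edges *)

Lemma edge_del_edge (T : finType) (G : sgraph T) (x y : T) : G x y ->
  edge_transpositions (del_edge G x y) = edge_transpositions G :\ tperm x y.
Proof.
move=> Gxy; apply/setP=> t; rewrite in_setD1.
apply/edge_transpositionsP/andP => [[u [v [/andP[Guv uv] ->]]]|[txy]].
  split; last by apply/edge_transpositionsP; exists u, v.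
  by apply: contraNneq uv => /(edge_transpositions_inj Guv) ->.
case/edge_transpositionsP=> u [v [Guv tE]]; exists u, v; split => //.
rewrite /= /del_edge_rel Guv /=; apply: contraNneq txy => e; rewrite tE.
have uv : u != v by apply: contraTneq Guv => ->; rewrite edge_irr.
have ue : u \in [set x; y] by rewrite -e set21.
have ve : v \in [set x; y] by rewrite -e set22.
move: ue ve uv; rewrite !inE => /orP[] /eqP-> /orP[] /eqP->; rewrite ?eqxx //.
by rewrite tpermC.
Qed.

Section BookGraphEdges.
Variable n : nat.

Let a : 'I_n.+2 := ord0.
Let b : 'I_n.+2 := Ordinal (isT : 1 < n.+2).
Let V := [seq i : 'I_n.+2 <- enum 'I_n.+2 | 1 < i].

Lemma B_outer i : (i \in V) = (1 < i).
Proof. by rewrite mem_filter mem_enum andbT. Qed.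

Lemma B_vertices : perm_eq (enum 'I_n.+2) (a :: b :: V).
Proof.
apply: uniq_perm; first exact: enum_uniq.
  by rewrite 2!cons_uniq in_cons !B_outer filter_uniq ?enum_uniq.
move=> i; rewrite mem_enum !in_cons B_outer.
by case: i => [[|[|i]] ?].
Qed.

Lemma B_vertices_uniq : uniq (a :: b :: V).
Proof. by rewrite -(perm_uniq B_vertices) enum_uniq. Qed.

Lemma B_outer_size : size V = n.
Proof. by have := perm_size B_vertices; rewrite size_enum_ord /= => -[]. Qed.

Lemma B_edges :
  perm_eq (enum (edge_transpositions (B_graph n))) (tperm a b :: spokes a b V).
Proof.
apply: uniq_perm; [exact: enum_uniq | exact: uniq_spokes B_vertices_uniq |].
have aE (i : 'I_n.+2) : i = 0 :> nat -> i = a by move=> ?; apply: val_inj.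
have bE (i : 'I_n.+2) : i = 1%N :> nat -> i = b by move=> ?; apply: val_inj.
have VE (i : 'I_n.+2) : 1 < i -> i \in V by rewrite B_outer.
move=> t; rewrite mem_enum; apply/edge_transpositionsP/idP.
  have arc x y : B_arc x y -> tperm x y \in tperm a b :: spokes a b V.
    rewrite in_cons mem_cat => /or3P[] /andP[/eqP x_ y_].
    - by rewrite (aE _ x_) (bE _ (eqP y_)) eqxx.
    - by rewrite (aE _ x_) map_f ?orbT // VE.
    - by rewrite (bE _ x_) [X in _ || (_ || X)]map_f ?orbT // VE.
  by case=> x [y [/orP[/arc|/arc] xy ->]] //; rewrite tpermC.
rewrite in_cons => /predU1P[->|]; first by exists a, b.
rewrite mem_cat => /orP[] /mapP[x]; rewrite B_outer => x1 ->.
  by exists a, x; split => //; rewrite /= /B_rel /B_arc /= x1 ?orbT.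
by exists b, x; split => //; rewrite /= /B_rel /B_arc /= x1 ?orbT.
Qed.

Lemma B_edges_card : #|edge_transpositions (B_graph n)| = n.*2.+1.
Proof. by rewrite cardE (perm_size B_edges) /= size_spokes B_outer_size. Qed.

Lemma B_perm_complete : perm_complete_graph (B_graph n).
Proof.
apply: (@perm_complete_perm _ (tperm a b :: spokes a b V)).
  by rewrite perm_sym B_edges.
have := B_vertices_uniq.
rewrite 2!cons_uniq in_cons negb_or => /and3P[/andP[ab aV] bV _].
(* There are [2n + 1] edges, so the products are odd and the set to reach is the nontrivial coset of
   the alternating group. *)
split=> //; right; apply/setP=> p.
rewrite in_setD Alt_even negbK [p \in 'Sym_ _]inE andbT.
apply/idP/idP => [pP|p_odd].
  rewrite (odd_Prod _ pP) /= ?size_spokes ?odd_double // => t.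
  rewrite in_cons => /predU1P[->|]; first by rewrite odd_tperm.
  exact: odd_spokes.
apply: book_complete => //; first exact: B_vertices_uniq.
by move=> z; rewrite -(perm_mem B_vertices) mem_enum.
Qed.

(** * Minimality *)

(** Connectedness is phrased by functions constant along edges, to match the class labelling of the
    genus bound. An outer vertex that loses its spoke to [a] is still joined to [b]; if the spine
    edge is deleted, vertex 2, present since [0 < n], links [a] to [b]. *)
Lemma B_del_edge_connected (f : 'I_n.+2 -> 'I_n.+2) (x y : 'I_n.+2) : 0 < n ->
    (forall u v, del_edge (B_graph n) x y u v -> f u = f v) ->
  forall z, f z = f a.
Proof.
move=> n_gt0 fE.
have fa (i : 'I_n.+2) : 1 < i -> [set a; i] != [set x; y] -> f i = f a.
  move=> i1 e; rewrite (fE a i) //=.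
  by rewrite /del_edge_rel e /= /B_rel /B_arc /= i1 ?orbT.
have fb (i : 'I_n.+2) : 1 < i -> [set b; i] != [set x; y] -> f i = f b.
  move=> i1 e; rewrite (fE b i) //=.
  by rewrite /del_edge_rel e /= /B_rel /B_arc /= i1 ?orbT.
have fab : f b = f a.
  have [e|e] := eqVneq [set a; b] [set x; y]; last first.
    by rewrite (fE a b) //= /del_edge_rel e.
  pose c : 'I_n.+2 := Ordinal (n_gt0 : 2 < n.+2).
  have c_ab : c \notin [set a; b] by rewrite !inE.
  have fca : f c = f a.
    apply: fa => //; rewrite -e.
    by apply: contraNneq c_ab => <-; rewrite set22.
  have fcb : f c = f b.
    apply: fb => //; rewrite -e.
    by apply: contraNneq c_ab => <-; rewrite set22.
  by rewrite -fcb.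
have f_out (i : 'I_n.+2) : 1 < i -> f i = f a.
  move=> i1; have [e|] := eqVneq [set a; i] [set x; y]; last exact: fa.
  rewrite (fb i) // -e; apply/eqP => /setP/(_ a).
  by rewrite set21 !inE /= -val_eqE /=; case: (i : nat) i1.
move=> z; have := perm_mem B_vertices z.
by rewrite mem_enum !in_cons B_outer => /esym/or3P[/eqP->|/eqP->|/f_out].
Qed.

Lemma B_del_edge_not_perm_complete (x y : 'I_n.+2) :
  B_graph n x y -> ~ perm_complete_graph (del_edge (B_graph n) x y).
Proof.
move=> Gxy; set G' := del_edge _ x y; pose s := enum (edge_transpositions G').
have sz : size s = n.*2.
  rewrite /s -cardE edge_del_edge //.
  have := cardsD1 (tperm x y) (edge_transpositions (B_graph n)).
  have -> : tperm x y \in edge_transpositions (B_graph n).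
    by apply/edge_transpositionsP; exists x, y.
  by rewrite B_edges_card => -[].
have s_tperm : {in s, forall t : {perm 'I_n.+2},
    exists u v, u != v /\ t = tperm u v}.
  move=> t; rewrite mem_enum => /edge_transpositionsP[u [v [Guv ->]]].
  by exists u, v; split=> //; apply: contraTneq Guv => ->; rewrite edge_irr.
case; rewrite -/s => s0 [] sP; last first.
  (* Evenly many edges remain, so their product is even and cannot lie in the odd coset. *)
  have := prod_in_Prod s; rewrite sP in_setD Alt_even negbK.
  rewrite (odd_Prod _ (prod_in_Prod s)) ?sz ?odd_double //.
  by move=> t /s_tperm[u [v [uv ->]]]; rewrite odd_tperm.
(* For [n = 0] the remaining sequence is empty, which [perm_complete] excludes. *)
have n_gt0 : 0 < n.
  by rewrite lt0n; apply/eqP => n0; apply: s0; apply: size0nil; rewrite sz n0.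
have /ProdP[r rs r1] : 1 \in Prod s by rewrite sP group1.
case: (@porbits_prod_transpositions _ r) => [t|f fr].
  by rewrite (perm_mem rs) => /s_tperm.
rewrite -r1 porbits1 card_ord (perm_size rs) sz.
have fE := @B_del_edge_connected f x y n_gt0.
have -> : f @: setT = [set f a].
  apply/setP=> z; rewrite !inE.
  apply/imsetP/eqP => [[w _ ->]|->]; last by exists a.
  apply: fE => u v Guv; rewrite -[LHS](fr (tperm u v)) ?tpermL //.
  rewrite (perm_mem rs) mem_enum; apply/edge_transpositionsP.
  by exists u, v.
(* With a single class, the bound for the product 1 would read [(n + 2) + (n + 2) <= 2n + 2]. *)
by rewrite cards1; clear; lia.
Qed.

End BookGraphEdges.

Theorem theorem2p11 (n : nat) : minimal_perm_complete_graph (B_graph n).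
Proof.
split; [exact: B_perm_complete | exact: B_del_edge_not_perm_complete].
Qed.
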